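(* Let $\varphi=\{\varphi_n\}_{n\in\mathbb{N}}$ and $\psi=\{\psi_n\}_{n\in\mathbb{N}}$ be dual frames for $\mathcal{H}$ with cross Gram operator $G_{\varphi,\psi}$, let $m=\{m_n\}_{n\in\mathbb{N}}\in\ell^\infty(\mathbb{N})$, and let $M_{m,\varphi,\psi}$ be the multiplier of $\varphi,\psi$ with symbol $m$. (i) If all the terms $m_n$ are contained in the closed disk of the complex plane of center $\mu\in\mathbb{C}$ with radius $R$, then the spectrum $\sigma(M_{m,\varphi,\psi})$ is contained in the closed disk of center $\mu$ with radius $R\,\|G_{\varphi,\psi}\|$. (ii) If $m$ is a real sequence, then $\sigma(M_{m,\varphi,\psi})$ is contained in the closed disk of center $$\frac12\Big(\sup_{n}m_n+\inf_{n}m_n\Big)$$ with radius $$\frac12\Big(\sup_{n}m_n-\inf_{n}m_n\Big)\|G_{\varphi,\psi}\|.$$ (iii) If $\psi$ is the canonical dual of $\varphi$, then $\sigma(M_{m,\varphi,\psi})$ is contained in the closed convex hull of $\{m_n:n\in\mathbb{N}\}$ in $\mathbb{C}$.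
   Context: $\mathcal{H}$ is a separable complex Hilbert space with inner product $\langle\cdot,\cdot\rangle$ (linear in the first argument) and norm $\|\cdot\|$. $\ell^2(\mathbb{N})$ and $\ell^\infty(\mathbb{N})$ are the spaces of square summable and bounded complex sequences indexed by $\mathbb{N}$. A sequence $\varphi=\{\varphi_n\}_{n\in\mathbb{N}}$ in $\mathcal{H}$ is a frame for $\mathcal{H}$ if there are $A_\varphi,B_\varphi>0$ with $A_\varphi\|f\|^2\leq\sum_{n\in\mathbb{N}}|\langle f,\varphi_n\rangle|^2\leq B_\varphi\|f\|^2$ for all $f\in\mathcal{H}$. Two frames $\varphi,\psi$ are dual frames if $f=\sum_{n\in\mathbb{N}}\langle f,\psi_n\rangle\varphi_n$ for all $f\in\mathcal{H}$ (equivalently, $f=\sum_{n\in\mathbb{N}}\langle f,\varphi_n\rangle\psi_n$ for all $f\in\mathcal{H}$). The frame operator of a frame $\varphi$ is $S_\varphi f=\sum_{n\in\mathbb{N}}\langle f,\varphi_n\rangle\varphi_n$, a bounded positive self-adjoint operator on $\mathcal{H}$ with bounded inverse; the canonical dual of $\varphi$ is the sequence $\{S_\varphi^{-1}\varphi_n\}_{n\in\mathbb{N}}$, which is a dual frame of $\varphi$. The analysis operator of $\psi$ is $C_\psi:\mathcal{H}\to\ell^2(\mathbb{N})$, $C_\psi f=\{\langle f,\psi_n\rangle\}_n$, and the synthesis operator of $\varphi$ is $D_\varphi:\ell^2(\mathbb{N})\to\mathcal{H}$, $D_\varphi\{c_n\}=\sum_n c_n\varphi_n$. The cross Gram operator of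 $\varphi,\psi$ is the bounded operator $G_{\varphi,\psi}=C_\psi D_\varphi:\ell^2(\mathbb{N})\to\ell^2(\mathbb{N})$, i.e. $G_{\varphi,\psi}\{c_n\}=\{d_k\}$ with $d_k=\sum_n c_n\langle\varphi_n,\psi_k\rangle$; $\|G_{\varphi,\psi}\|$ is its operator norm. The multiplier of $\varphi,\psi$ with symbol $m\in\ell^\infty(\mathbb{N})$ is the bounded operator on $\mathcal{H}$ given by $M_{m,\varphi,\psi}f=\sum_{n\in\mathbb{N}}m_n\langle f,\psi_n\rangle\varphi_n$. $\sigma(T)$ denotes the spectrum of a bounded operator $T$. *)

(* Defs.v *)
(* Scalars are R[i] (mathcomp-real-closed) for R : realType.
   In a normed module over R[i] the norm `|x| is itself an element of R[i]
   (a nonnegative real one); complex.Re `|x| is that norm as an element of R.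
   The normed structure of R[i] is the one the library puts on R[i]^o. *)
From HB Require Import structures.
From mathcomp Require Import all_boot all_order all_algebra sesquilinear.
From mathcomp Require Import complex.
From mathcomp Require Import all_classical all_reals all_analysis.

Set Implicit Arguments.
Unset Strict Implicit.
Unset Printing Implicit Defensive.

Import Order.TTheory GRing.Theory Num.Theory Num.Def.
Import numFieldNormedType.Exports.

Local Open Scope classical_set_scope.
Local Open Scope complex_scope.
Local Open Scope ring_scope.

Definition separable (T : topologicalType) : Prop :=
  exists2 D : set T, countable D & dense D.

Section LittleL2.
Variable R : realType.
Implicit Type c : nat -> R[i].

Definition l2sum c : \bar R :=
  (\sum_(0 <= n <oo) ((complex.Re `|c n|) ^+ 2)%:E)%E.

Definition is_l2 c : Prop := (l2sum c < +oo)%E.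

Definition l2norm c : R := Num.sqrt (fine (l2sum c)).

(* meaningful for an operator that maps l2 to l2 and is bounded there *)
Definition l2opnorm (T : (nat -> R[i]) -> (nat -> R[i])) : R :=
  sup [set l2norm (T c) | c in [set c | is_l2 c /\ l2norm c <= 1]].

End LittleL2.

Section BoundedOperators.
Variables (R : realType) (H : normedModType R[i]).

Definition bounded_inverse (T : H -> H) (S : {linear H -> H}) : Prop :=
  [/\ continuous S, cancel T S & cancel S T].

Definition spectrum (T : H -> H) : set R[i] :=
  [set l | ~ exists S : {linear H -> H},
             bounded_inverse (fun f => T f - l *: f) S].

End BoundedOperators.

Section Frames.
Variables (R : realType) (H : completeNormedModType R[i]).
Variable ip : {dot H for conjC}.
Implicit Types (phi psi : nat -> H) (m c : nat -> R[i]) (f : H).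

(* {dot H for conjC} is linear in its first argument, Hermitian and positive
   definite; this says that it induces the norm of the complete space H. *)
Definition induces_norm : Prop := forall f, ip f f = `|f| ^+ 2.

Definition analysis psi f : nat -> R[i] := fun n => ip f (psi n).

Definition synthesis phi c : H := limn (series (fun n => c n *: phi n)).

Definition is_frame phi : Prop :=
  exists A B : R, [/\ 0 < A, 0 < B & forall f,
    ((A * complex.Re `|f| ^+ 2)%:E <= l2sum (analysis phi f)
       <= (B * complex.Re `|f| ^+ 2)%:E)%E].

Definition dual_frames phi psi : Prop :=
  [/\ is_frame phi, is_frame psi &
      forall f, series (fun n => ip f (psi n) *: phi n) @ \oo --> f].

Definition frame_operator phi f : H :=
  limn (series (fun n => ip f (phi n) *: phi n)).

Definition is_canonical_dual phi psi : Prop :=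
  exists2 S : {linear H -> H},
    bounded_inverse (frame_operator phi) S & forall n, psi n = S (phi n).

Definition cross_gram phi psi c : nat -> R[i] :=
  analysis psi (synthesis phi c).

Definition multiplier m phi psi f : H :=
  limn (series (fun n => (m n * ip f (psi n)) *: phi n)).

End Frames.

Section ComplexPlane.
Variable R : realType.

(* library closed_ball is the closure of an open ball, hence empty for r = 0 *)
Definition closed_disk (mu : R[i]) (r : R) : set R[i] :=
  closed_ball_ (fun z : R[i] => `|z|) mu r%:C.

(* convex_set takes its weights in {i01 R[i]}: the real scalars in [0, 1] *)
Definition closed_convex_hull (A : set R[i]^o) : set R[i]^o :=
  smallest (fun B : set R[i]^o => closed B /\ convex_set B) A.

End ComplexPlane.

(* Main.v *)
Require Import Defs.
From HB Require Import structures.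
From mathcomp Require Import all_boot all_order all_algebra sesquilinear.
From mathcomp Require Import complex.
From mathcomp Require Import all_classical all_reals all_analysis.
From mathcomp Require Import ring lra.

Set Implicit Arguments.
Unset Strict Implicit.
Unset Printing Implicit Defensive.

Import Order.TTheory GRing.Theory Num.Theory Num.Def.
Import numFieldNormedType.Exports.

Local Open Scope classical_set_scope.
Local Open Scope complex_scope.
Local Open Scope ring_scope.

(* Write C, D for analysis by psi and synthesis by phi, so that G = C D and
   D C = 1, and let a = m - mu.  Then M_m - lambda = D a C - (lambda - mu), and
   (D a C)^(k+1) = D (a G)^k a C has norm O((R ||G||)^k); the Neumann series
   therefore inverts M_m - lambda as soon as |lambda - mu| > R ||G||, which
   is (i).  Part (ii) is the case where the disk has the interval
   [inf m, sup m] as a diameter.  For the canonical dual ||G|| <= 1, and (iii)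
   follows from (i) because a bounded closed convex set in the plane is an
   intersection of closed disks. *)

(** * Real-valued norms, convergence and continuity over complex scalars *)

Section RealNorm.
Variable R : realType.

(** The order of [R[i]] is partial; in [R] the values of the norm are totally ordered and have
    suprema. *)
Definition nrm (V : normedZmodType R[i]) (x : V) : R := complex.Re `|x|.

Lemma normE (V : normedZmodType R[i]) (x : V) : `|x| = (nrm x)%:C.
Proof. by rewrite /nrm RRe_real ?ger0_real ?normr_ge0. Qed.

Lemma nrm_ge0 (V : normedZmodType R[i]) (x : V) : 0 <= nrm x.
Proof. by rewrite -ler0c -normE normr_ge0. Qed.

Lemma nrmD (V : normedZmodType R[i]) (x y : V) : nrm (x + y) <= nrm x + nrm y.
Proof. by rewrite -lecR rmorphD/= -!normE ler_normD. Qed.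

Lemma nrmN (V : normedZmodType R[i]) (x : V) : nrm (- x) = nrm x.
Proof. by rewrite /nrm normrN. Qed.

Lemma nrm0 (V : normedZmodType R[i]) : nrm (0 : V) = 0.
Proof. by rewrite /nrm normr0. Qed.

Lemma nrm_eq0 (V : normedZmodType R[i]) (x : V) : nrm x = 0 -> x = 0.
Proof. by move=> x0; apply/eqP; rewrite -normr_eq0 normE x0. Qed.

Lemma nrmZ (V : normedModType R[i]) (a : R[i]) (x : V) :
  nrm (a *: x) = nrm a * nrm x.
Proof. by apply: complexI; rewrite rmorphM/= -!normE normrZ. Qed.

Lemma nrmM (a b : R[i]) : nrm (a * b) = nrm a * nrm b.
Proof. by apply: complexI; rewrite rmorphM/= -!normE normrM. Qed.

Lemma nrmX (a : R[i]) n : nrm (a ^+ n) = nrm a ^+ n.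
Proof. by apply: complexI; rewrite rmorphXn/= -!normE normrX. Qed.

Lemma nrmV (a : R[i]) : nrm a^-1 = (nrm a)^-1.
Proof. by apply: complexI; rewrite fmorphV/= -!normE normfV. Qed.

Lemma nrm_real (x : R) : nrm (x%:C : R[i]) = `|x|.
Proof. by rewrite /nrm normc_def/= expr0n/= addr0 sqrtr_sqr. Qed.

Lemma nrm_sqr (z : R[i]) : nrm z ^+ 2 = complex.Re z ^+ 2 + complex.Im z ^+ 2.
Proof. by rewrite /nrm normc_def/= sqr_sqrtr// addr_ge0// sqr_ge0. Qed.

Lemma nrm_conjC (z : R[i]) : nrm (conjC z) = nrm z.
Proof. by rewrite /nrm norm_conjC. Qed.

Lemma cvg_nrmP (V : normedModType R[i]) (u : nat -> V) (l : V) :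
  u @ \oo --> l <->
  forall e : R, 0 < e -> \forall n \near \oo, nrm (l - u n) < e.
Proof.
split => [/cvgrPdist_lt ul e e0|ul].
  have /ul : 0 < e%:C :> R[i] by rewrite ltcR.
  by apply: filterS => n; rewrite normE ltcR.
apply/cvgrPdist_lt => e e0.
have eE : e = (complex.Re e)%:C by rewrite RRe_real// gtr0_real.
have /ul : 0 < complex.Re e by rewrite -ltcR -eE.
by apply: filterS => n; rewrite normE eE ltcR.
Qed.

Lemma cvg_nrm_lim_le (V : normedModType R[i]) (u : nat -> V) (l : V) (K : R) :
  u @ \oo --> l -> (forall n, nrm (u n) <= K) -> nrm l <= K.
Proof.
move=> /cvg_nrmP ul uK; apply/ler_addgt0Pr => e e0.
have [n _ /(_ n (leqnn n))/= ln] := ul _ e0.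
rewrite -(subrK (u n) l) (le_trans (nrmD _ _))// addrC lerD//.
exact: ltW.
Qed.

Lemma cauchy_series_nrm (V : completeNormedModType R[i]) (u : nat -> V) :
  (forall e : R, 0 < e -> exists N, forall m n, (N <= m)%N -> (m <= n)%N ->
     nrm (\sum_(m <= k < n) u k) < e) -> cvgn (series u).
Proof.
move=> uc; apply/cauchy_cvgP/cauchy_seriesP => e e0.
have eE : e = (complex.Re e)%:C by rewrite RRe_real// gtr0_real.
have /uc[N hN] : 0 < complex.Re e by rewrite -ltcR -eE.
exists ([set n | (N <= n)%N], [set n | (N <= n)%N]) => /=.
  by split; exact: nbhs_infty_ge.
move=> [m n] [/= Nm Nn]; rewrite normE eE ltcR.
have [mn|nm] := leqP m n; first exact: hN.
by rewrite big_geq ?(ltnW nm)// nrm0 -ltcR -eE.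
Qed.

Lemma nrm_bounded_continuous (V W : normedModType R[i]) (T : V -> W) (K : R) :
  linear T -> (forall x, nrm (T x) <= K * nrm x) -> continuous T.
Proof.
move=> linT TK x.
pose T' : {linear V -> W} := HB.pack T (GRing.isLinear.Build _ _ _ _ T linT).
have TB y z : T (y - z) = T y - T z by rewrite -[T]/(T' : _ -> _) linearB.
(* Adding 1 keeps the divisor of [e] positive even when [K] is 0. *)
have K1 : 0 < `|K| + 1 by rewrite ltr_wpDl.
apply/cvgrPdist_lt => e e0.
have eE : e = (complex.Re e)%:C by rewrite RRe_real// gtr0_real.
have {}e0 : 0 < complex.Re e by rewrite -ltcR -eE.
near=> y; rewrite -TB normE eE ltcR (le_lt_trans (TK _))//.
have : nrm (x - y) < complex.Re e / (`|K| + 1).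
  rewrite -ltcR -normE; near: y; apply: cvgr_dist_lt => //.
  by rewrite ltcR divr_gt0.
rewrite ltr_pdivlMr//; apply: le_lt_trans.
rewrite mulrC ler_wpM2l ?nrm_ge0// ler_wpDr//.
exact: ler_norm.
Unshelve. all: by end_near. Qed.

End RealNorm.

(** * Square summable sequences through their partial sums *)

Section LittleL2Theory.
Variable R : realType.
Implicit Types (c : nat -> R[i]) (K : R).

(** The terms are nonnegative, so the series is the supremum of its partial sums; norm estimates
    thereby become estimates of finite sums. *)
Lemma l2sum_leP c K : (l2sum c <= K%:E)%E <->
  forall N, \sum_(0 <= n < N) nrm (c n) ^+ 2 <= K.
Proof.
have c0 n : (0 <= n)%N -> xpredT n ->
  (0 <= ((complex.Re `|c n|) ^+ 2)%:E :> \bar R)%E.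
  by move=> _ _; rewrite lee_fin sqr_ge0.
split => [cK N|cK].
  rewrite -lee_fin (le_trans _ cK)// -sumEFin.
  by apply: nneseries_lim_ge => n _; rewrite lee_fin sqr_ge0.
apply: lime_le; first exact: is_cvg_nneseries.
by apply: nearW => N; rewrite sumEFin lee_fin; exact: cK.
Qed.

Lemma l2sum_ge0 c : (0 <= l2sum c)%E.
Proof. by apply: nneseries_ge0 => n _ _; rewrite lee_fin sqr_ge0. Qed.

Lemma l2norm_ge0 c : 0 <= l2norm c.
Proof. exact: sqrtr_ge0. Qed.

Lemma l2norm_sum c : is_l2 c -> l2sum c = (l2norm c ^+ 2)%:E.
Proof.
move=> c2; have cfin : l2sum c \is a fin_num by rewrite ge0_fin_numE// l2sum_ge0.
by rewrite /l2norm sqr_sqrtr ?fineK// fine_ge0 ?l2sum_ge0.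
Qed.

(** The conjunct [is_l2 c] matters: [fine] sends [+oo] to 0, so a divergent series has
    [l2norm c = 0]. *)
Lemma l2norm_leP c K : 0 <= K ->
  is_l2 c /\ l2norm c <= K <->
  forall N, \sum_(0 <= n < N) nrm (c n) ^+ 2 <= K ^+ 2.
Proof.
move=> K0; rewrite -l2sum_leP; split => [[c2 cK]|cK].
  by rewrite l2norm_sum// lee_fin ler_sqr ?nnegrE ?l2norm_ge0.
have c2 : is_l2 c by rewrite /is_l2 (le_lt_trans cK)// ltry.
by split => //; rewrite -ler_sqr ?nnegrE ?l2norm_ge0// -lee_fin -l2norm_sum.
Qed.

Lemma is_l2_psum c : is_l2 c ->
  forall N, \sum_(0 <= n < N) nrm (c n) ^+ 2 <= l2norm c ^+ 2.
Proof. by move=> c2; apply/l2norm_leP; rewrite ?l2norm_ge0. Qed.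

Lemma is_l2Z (a : R[i]) c : is_l2 c ->
  is_l2 (fun n => a * c n) /\ l2norm (fun n => a * c n) <= nrm a * l2norm c.
Proof.
move=> c2; apply/l2norm_leP; first by rewrite mulr_ge0 ?nrm_ge0 ?l2norm_ge0.
move=> N; rewrite exprMn (le_trans _ (ler_wpM2l (sqr_ge0 _) (is_l2_psum c2 N)))//.
by rewrite mulr_sumr; apply: ler_sum => n _; rewrite nrmM exprMn.
Qed.

Lemma is_l2M (a c : nat -> R[i]) r : 0 <= r -> (forall n, nrm (a n) <= r) ->
  is_l2 c ->
  is_l2 (fun n => a n * c n) /\ l2norm (fun n => a n * c n) <= r * l2norm c.
Proof.
move=> r0 ar c2; apply/l2norm_leP; first by rewrite mulr_ge0 ?l2norm_ge0.
move=> N; rewrite exprMn (le_trans _ (ler_wpM2l (sqr_ge0 _) (is_l2_psum c2 N)))//.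
rewrite mulr_sumr; apply: ler_sum => n _; rewrite nrmM exprMn ler_wpM2r ?sqr_ge0//.
by rewrite ler_sqr ?nnegrE ?nrm_ge0.
Qed.

(** The partial sums are nondecreasing and bounded by [l2norm c ^+ 2], hence Cauchy. *)
Lemma is_l2_tail c (e : R) : is_l2 c -> 0 < e ->
  exists N, forall m n, (N <= m)%N -> (m <= n)%N ->
    \sum_(m <= k < n) nrm (c k) ^+ 2 < e.
Proof.
move=> c2 e0; pose u k := nrm (c k) ^+ 2.
have : cvgn (series u).
  apply: nondecreasing_is_cvgn.
    by apply/nondecreasing_seqP => n; rewrite /series/= big_nat_recr//= ler_wpDr ?sqr_ge0.
  exists (l2norm c ^+ 2) => _ [N _ <-]; exact: is_l2_psum.
move=> /cauchy_cvgP/cauchy_seriesP/(_ _ e0)[[A B] [[N1 _ A1] [N2 _ B2]] AB].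
exists (maxn N1 N2) => m n; rewrite geq_max => /andP[N1m N2m] mn.
apply: le_lt_trans (AB (m, n) _); first exact: ler_norm.
by split => /=; [exact: A1|apply: B2 => /=; exact: leq_trans mn].
Qed.

End LittleL2Theory.

(** * Cauchy-Schwarz, Bessel sequences, analysis and synthesis *)

Section InnerProduct.
Variables (R : realType) (H : completeNormedModType R[i]).
Variable ip : {dot H for conjC}.
Hypothesis hip : induces_norm ip.
Implicit Types (u v : H).

Lemma ip_conj u v : ip u v = conjC (ip v u).
Proof. by rewrite (hermC ip) expr0 mul1r. Qed.

Lemma nrm_ipC u v : nrm (ip u v) = nrm (ip v u).
Proof. by rewrite ip_conj nrm_conjC. Qed.

Lemma ip_diag u : ip u u = (nrm u ^+ 2)%:C.
Proof. by rewrite hip normE rmorphXn. Qed.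

Lemma cauchy_schwarz u v : nrm (ip u v) <= nrm u * nrm v.
Proof.
have [v0|v0] := eqVneq (nrm v) 0.
  by rewrite (nrm_eq0 v0) linear0r !nrm0 mulr0.
have vpos : 0 < nrm v ^+ 2 by rewrite exprn_gt0// lt_def v0 nrm_ge0.
rewrite -ler_sqr ?nnegrE ?mulr_ge0 ?nrm_ge0// exprMn.
pose s := (nrm v ^+ 2)^-1; pose a := ip u v.
have realK (r : R) : conjC (r%:C : R[i]) = r%:C.
  by apply/CrealP; rewrite complex_real.
have dE : ip u ((s%:C * a) *: v) = (s * nrm a ^+ 2)%:C.
  rewrite linearZr_LR/= -/a rmorphM/= realK -mulrA [conjC a * a]mulrC -normCK.
  by rewrite normE rmorphM rmorphXn.
(* [(s%:C * a) *: v] is the orthogonal projection of [u] on [v]; the squared norm of the remainder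
   is |u|^2 - s |a|^2, which is nonnegative. *)
have := dnormB ip u ((s%:C * a) *: v).
rewrite /= dE realK dnormZ !ip_diag normE -rmorphXn -rmorphM/=.
rewrite -!rmorphD -rmorphN -rmorphD => /complexI E.
have {E} : 0 <= nrm u ^+ 2 + nrm (s%:C * a) ^+ 2 * nrm v ^+ 2
    - (s * nrm a ^+ 2 + s * nrm a ^+ 2) by rewrite -E sqr_ge0.
rewrite nrmM exprMn nrm_real real_normK ?num_real//.
have -> : s ^+ 2 * nrm a ^+ 2 * nrm v ^+ 2 = s * nrm a ^+ 2.
  by rewrite /s; field; rewrite v0.
rewrite opprD addrA addrK subr_ge0 /s mulrC ler_pdivrMr//.
Qed.

Lemma cvg_ipl (u : nat -> H) l v :
  u @ \oo --> l -> (fun n => ip (u n) v : R[i]^o) @ \oo --> (ip l v : R[i]^o).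
Proof.
move=> /cvg_nrmP ul; apply/cvg_nrmP => e e0.
have K0 : 0 < nrm v + 1 by rewrite ltr_wpDl ?nrm_ge0.
have /ul : 0 < e / (nrm v + 1) by rewrite divr_gt0.
apply: filterS => n; rewrite -linearBl ltr_pdivlMr// => h.
rewrite (le_lt_trans (cauchy_schwarz _ _))// (le_lt_trans _ h)//.
by rewrite ler_wpM2l ?nrm_ge0// ler_wpDr.
Qed.

Lemma cvg_ipr (u : nat -> H) l v :
  u @ \oo --> l -> (fun n => ip v (u n) : R[i]^o) @ \oo --> (ip v l : R[i]^o).
Proof.
move=> /(@cvg_ipl _ _ v)/cvg_nrmP ul; apply/cvg_nrmP => e /ul.
apply: filterS => n; rewrite (ip_conj v l) (ip_conj v (u n)) -rmorphB.
by rewrite nrm_conjC.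
Qed.

(** The upper frame bound, put on partial sums so that it applies directly to finite sums. *)
Definition bessel (phi : nat -> H) (B : R) :=
  forall f N, \sum_(0 <= n < N) nrm (ip f (phi n)) ^+ 2 <= B * nrm f ^+ 2.

Lemma frame_bessel phi : is_frame ip phi -> exists2 B, 0 < B & bessel phi B.
Proof.
move=> [A [B [A0 B0 AB]]]; exists B => // f; apply/l2sum_leP.
by have /andP[] := AB f.
Qed.

Section Bessel.
Variables (phi : nat -> H) (B : R).
Hypotheses (B0 : 0 < B) (phiB : bessel phi B).

Lemma analysis_l2 f : is_l2 (analysis ip phi f) /\
  l2norm (analysis ip phi f) <= Num.sqrt B * nrm f.
Proof.
apply/l2norm_leP; first by rewrite mulr_ge0 ?sqrtr_ge0 ?nrm_ge0.
by move=> N; rewrite exprMn sqr_sqrtr ?(ltW B0)//; exact: phiB.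
Qed.

(** Pairing the finite sum h with itself gives |h|^2 <= sum |c_k| |<h, phi_k>|. AM-GM and the Bessel
    bound at h itself turn this into 2 |h|^2 <= B sum |c_k|^2 + |h|^2, and one |h|^2 is absorbed on
    the left. *)
Lemma bessel_partial (c : nat -> R[i]) m n : (m <= n)%N ->
  nrm (\sum_(m <= k < n) c k *: phi k) ^+ 2 <=
  B * \sum_(m <= k < n) nrm (c k) ^+ 2.
Proof.
move=> mn; set h := \sum_(m <= k < n) c k *: phi k.
have hE : nrm h ^+ 2 <= \sum_(m <= k < n) nrm (c k) * nrm (ip h (phi k)).
  rewrite -(ger0_norm (sqr_ge0 (nrm h))) -nrm_real -ip_diag.
  rewrite {1}/h linear_sumlz -/h.
  elim/big_ind2 : _ => [|x1 x2 y1 y2 h1 h2|k _].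
  - by rewrite nrm0.
  - by rewrite (le_trans (nrmD _ _))// lerD.
  - by rewrite linearZl_LR/= nrmM (nrm_ipC (phi k)).
have hB : \sum_(m <= k < n) nrm (ip h (phi k)) ^+ 2 <= B * nrm h ^+ 2.
  apply: le_trans (phiB h n).
  by rewrite [leRHS](big_cat_nat (n := m))//= lerDr sumr_ge0// => k _; rewrite sqr_ge0.
(* AM-GM: [2 |c_k| |<h, phi_k>| <= B |c_k|^2 + |<h, phi_k>|^2 / B] *)
have amgm : 2 * (\sum_(m <= k < n) nrm (c k) * nrm (ip h (phi k))) <=
    B * \sum_(m <= k < n) nrm (c k) ^+ 2
    + B^-1 * \sum_(m <= k < n) nrm (ip h (phi k)) ^+ 2.
  rewrite !mulr_sumr -big_split/=; apply: ler_sum => k _.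
  set x := nrm (c k); set y := nrm _.
  rewrite -subr_ge0 (_ : _ - _ = B^-1 * (B * x - y) ^+ 2).
    by rewrite mulr_ge0 ?sqr_ge0// invr_ge0 ltW.
  by field; rewrite gt_eqF.
have : B^-1 * \sum_(m <= k < n) nrm (ip h (phi k)) ^+ 2 <= nrm h ^+ 2.
  by rewrite mulrC ler_pdivrMr// mulrC.
lra.
Qed.

Lemma synthesis_cvg c : is_l2 c ->
  series (fun n => c n *: phi n) @ \oo --> synthesis phi c.
Proof.
move=> c2; apply: cauchy_series_nrm => e e0.
have [|N hN] := @is_l2_tail _ c (e ^+ 2 / B) c2.
  by rewrite divr_gt0 ?exprn_gt0.
exists N => m n Nm mn; rewrite -ltr_sqr ?nnegrE ?nrm_ge0 ?ltW//.
rewrite (le_lt_trans (bessel_partial c mn))//.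
by rewrite mulrC -ltr_pdivlMr// hN.
Qed.

Lemma synthesis_le c : is_l2 c ->
  nrm (synthesis phi c) <= Num.sqrt B * l2norm c.
Proof.
move=> c2; apply: (cvg_nrm_lim_le (synthesis_cvg c2)) => n.
rewrite -ler_sqr ?nnegrE ?nrm_ge0 ?mulr_ge0 ?l2norm_ge0 ?sqrtr_ge0//.
rewrite exprMn sqr_sqrtr ?(ltW B0)//.
apply: le_trans (bessel_partial c (leq0n n)) _.
by rewrite ler_wpM2l ?(ltW B0)//; exact: is_l2_psum.
Qed.

(** The combination [e] is given pointwise, so that the same lemma serves for linearity of
    multipliers, for scaling in the cross Gram operator and for splitting a symbol. *)
Lemma synthesisP (a : R[i]) c d e : is_l2 c -> is_l2 d ->
  (forall n, e n = a * c n + d n) ->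
  synthesis phi e = a *: synthesis phi c + synthesis phi d.
Proof.
move=> c2 d2 eE; apply: (@cvg_lim H) => //.
have -> : series (fun n => e n *: phi n) =
    (fun N => a *: series (fun n => c n *: phi n) N
              + series (fun n => d n *: phi n) N).
  apply/funext => N; rewrite /series/= scaler_sumr -big_split/=.
  by apply: eq_bigr => n _; rewrite eE scalerDl scalerA.
by apply: cvgD; [apply: cvgZr|]; exact: synthesis_cvg.
Qed.

End Bessel.

End InnerProduct.

(** * Neumann series under a growth condition on iterates *)

Section Neumann.
Variables (R : realType) (H : completeNormedModType R[i]).

Lemma geometric_tail (K z e : R) : 0 <= K -> 0 <= z < 1 -> 0 < e ->
  exists N, forall m n, (N <= m)%N -> (m <= n)%N ->
    \sum_(m <= k < n) K * z ^+ k < e.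
Proof.
move=> K0 /andP[z0 z1] e0.
have : cvgn (series (geometric K z)).
  by apply: is_cvg_geometric_series; rewrite ger0_norm.
move=> /cauchy_cvgP/cauchy_seriesP/(_ _ e0)[[A B] [[N1 _ A1] [N2 _ B2]] AB].
exists (maxn N1 N2) => m n; rewrite geq_max => /andP[N1m N2m] mn.
apply: le_lt_trans (AB (m, n) _); first exact: ler_norm.
by split => /=; [exact: A1|apply: B2 => /=; exact: leq_trans mn].
Qed.

Lemma linear_iter (T : {linear H -> H}) k : linear (iter k T).
Proof. by elim: k => // k IH a x y; rewrite /= IH linearP. Qed.

(** The inverse is S f = - sum_k nu^-(k+1) T^k f. Only the growth rate [q] of the iterates has to
    lie below |nu|; the norm of [T] may be larger, the excess going into [K]. *)
Lemma neumann_inverse (T : H -> H) (K q : R) (nu : R[i]) :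
  linear T -> 0 <= K -> 0 <= q < nrm nu ->
  (forall k f, nrm (iter k T f) <= K * q ^+ k * nrm f) ->
  exists S : {linear H -> H}, bounded_inverse (fun f => T f - nu *: f) S.
Proof.
move=> linT K0 /andP[q0 qnu] TK.
pose T' : {linear H -> H} := HB.pack T (GRing.isLinear.Build _ _ _ _ T linT).
have TD x y : T (x + y) = T x + T y := linearD T' x y.
have TZ a x : T (a *: x) = a *: T x by rewrite -[T]/(T' : H -> H) linearZ.
have nu0 : 0 < nrm nu := le_lt_trans q0 qnu.
have nuN0 : nu != 0 by apply/eqP => nuE; rewrite nuE nrm0 ltxx in nu0.
pose z := q / nrm nu.
have z01 : 0 <= z < 1 by rewrite divr_ge0 ?nrm_ge0//= ltr_pdivrMr// mul1r.
pose u f k := - (nu^-1 ^+ k.+1) *: iter k T f.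
pose s f := series (u f).
have u_le f k : nrm (u f k) <= K * nrm f / nrm nu * z ^+ k.
  rewrite /u nrmZ nrmN nrmX nrmV exprS expr_div_n.
  rewrite (le_trans (ler_wpM2l _ (TK k f)))//.
    by rewrite mulr_ge0 ?exprn_ge0// invr_ge0 ltW.
  by rewrite exprVn le_eqVlt; apply/orP; left; apply/eqP; ring.
have s_cvg f : cvgn (s f).
  apply: cauchy_series_nrm => e e0.
  have [|N hN] := @geometric_tail (K * nrm f / nrm nu) z e _ z01 e0.
    by rewrite divr_ge0 ?mulr_ge0 ?nrm_ge0.
  exists N => m n Nm mn; apply: le_lt_trans (hN m n Nm mn).
  elim/big_ind2 : _ => [|x1 x2 y1 y2 h1 h2|k _]; rewrite ?nrm0//.
  by rewrite (le_trans (nrmD _ _))// lerD.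
pose S f := limn (s f).
have SE f : s f @ \oo --> S f := s_cvg f.
have s_lin n a f g : s (a *: f + g) n = a *: s f n + s g n.
  rewrite /s /series/= scaler_sumr -big_split/=; apply: eq_bigr => k _.
  by rewrite /u (linear_iter T') scalerDr !scalerA mulrC.
have linS : linear S.
  move=> a f g; apply: (@cvg_lim H) => //.
  rewrite (_ : s _ = (fun n => a *: s f n + s g n)); last first.
    by apply/funext => n; rewrite s_lin.
  by apply: cvgD; [apply: cvgZr|]; exact: SE.
have S_le f : nrm (S f) <= K / nrm nu / (1 - z) * nrm f.
  apply: (cvg_nrm_lim_le (SE f)) => n.
  apply: (@le_trans _ _ (\sum_(0 <= k < n) K * nrm f / nrm nu * z ^+ k)).
    rewrite /s /series/=; elim/big_ind2 : _ => [|x1 x2 y1 y2 h1 h2|k _]//.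
      by rewrite nrm0.
    by rewrite (le_trans (nrmD _ _))// lerD.
  have z1 : 0 < 1 - z by case/andP: z01 => _; rewrite subr_gt0.
  have := geometric_seriesE (K * nrm f / nrm nu) (negbT (lt_eqF (proj2 (andP z01)))).
  rewrite /series/= => /(congr1 (fun h => h n))/= ->.
  rewrite [leRHS](_ : _ = K * nrm f / nrm nu / (1 - z)); last by ring.
  rewrite ler_wpM2r ?invr_ge0 ?(ltW z1)// ler_piMr//.
    by rewrite divr_ge0 ?mulr_ge0 ?nrm_ge0.
  by case/andP: z01 => ? _; rewrite gerBl exprn_ge0.
have contT : continuous T.
  by apply: (nrm_bounded_continuous linT (K := K * q)) => f; exact: (TK 1%N f).
(* Partial sums invert T - nu up to the error nu^-n T^n f, which the growth condition sends to 0. *)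
have telescope f n : T (s f n) - nu *: s f n = f - nu^-1 ^+ n *: iter n T f.
  elim: n => [|n IH].
    rewrite /s /series/= big_geq// expr0 scale1r subrr scaler0 subr0.
    exact: (linear0 T').
  have sS : s f n.+1 = s f n + u f n by rewrite /s seriesSr.
  rewrite sS TD scalerDr opprD addrACA IH /u TZ scalerA mulrN exprS mulrA.
  by rewrite mulfV// mul1r !scaleNr opprK [- _ + _]addrC addrA subrK -exprS.
have residual f : (fun n => f - nu^-1 ^+ n *: iter n T f) @ \oo --> f.
  apply/cvg_nrmP => e e0.
  have [|N hN] := @geometric_tail (K * nrm f) z e _ z01 e0.
    by rewrite mulr_ge0 ?nrm_ge0.
  exists N => // n /= Nn; rewrite opprB addrCA subrr addr0 nrmZ nrmX nrmV.
  (* A one-term slice of the geometric tail is the n-th term itself. *)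
  apply: le_lt_trans (hN n n.+1 Nn (leqnSn n)).
  rewrite big_nat1 (le_trans (ler_wpM2l _ (TK n f)))//.
    by rewrite exprn_ge0// invr_ge0 ltW.
  by rewrite expr_div_n exprVn le_eqVlt; apply/orP; left; apply/eqP; ring.
have right f : T (S f) - nu *: S f = f.
  have lim1 : (fun n => T (s f n) - nu *: s f n) @ \oo --> T (S f) - nu *: S f.
    apply: cvgB; last by apply: cvgZr; exact: SE.
    by apply: continuous_cvg; [exact: contT|exact: SE].
  have := residual f; under eq_fun do rewrite -telescope.
  by move=> lim2; exact: (@cvg_unique _ (@norm_hausdorff _ H) _ _ _ _ lim1 lim2).
(* Partial sums commute with T - nu, so being a left inverse follows from being a right inverse. *)
have sT f n : s (T f - nu *: f) n = T (s f n) - nu *: s f n.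
  elim: n => [|n IH].
    rewrite /s /series/= !big_geq// scaler0 subr0.
    by rewrite -[T 0]/(T' 0) linear0.
  have sS g : s g n.+1 = s g n + u g n by rewrite /s seriesSr.
  rewrite !sS IH TD scalerDr opprD addrACA; congr (_ + _).
  have -> : T f - nu *: f = (- nu) *: f + T f by rewrite scaleNr addrC.
  rewrite /u (linear_iter T') TZ scalerDr -iterSr !scalerA addrC; congr (_ + _).
  by rewrite -scaleNr; congr (_ *: _); ring.
pose S' : {linear H -> H} := HB.pack S (GRing.isLinear.Build _ _ _ _ S linS).
exists S'; split.
- exact: (nrm_bounded_continuous linS S_le).
- move=> f; rewrite -[RHS]right -[S' _]/(S _).
  have lim1 := SE (T f - nu *: f).
  have lim2 : s (T f - nu *: f) @ \oo --> T (S f) - nu *: S f.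
    rewrite (_ : s _ = (fun n => T (s f n) - nu *: s f n)); last first.
      by apply/funext => n; rewrite sT.
    apply: cvgB; last by apply: cvgZr; exact: SE.
    by apply: continuous_cvg; [exact: contT|exact: SE].
  exact: (@cvg_unique _ (@norm_hausdorff _ H) _ _ _ _ lim1 lim2).
- exact: right.
Qed.

End Neumann.

(** * The cross Gram norm and the iterates of a multiplier *)

Section Multipliers.
Variables (R : realType) (H : completeNormedModType R[i]).
Variable ip : {dot H for conjC}.
Hypothesis hip : induces_norm ip.
Variables (phi psi : nat -> H).
Hypothesis hdual : dual_frames ip phi psi.

Let G := cross_gram ip phi psi.

Lemma dual_bessel : exists B B' : R,
  [/\ 0 < B, 0 < B', bessel ip phi B & bessel ip psi B'].
Proof.
have [fphi fpsi _] := hdual.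
have [B B0 hB] := frame_bessel fphi; have [B' B'0 hB'] := frame_bessel fpsi.
by exists B, B'.
Qed.

Lemma analysisP a f g n :
  analysis ip psi (a *: f + g) n = a * analysis ip psi f n + analysis ip psi g n.
Proof. by rewrite /analysis linearPl. Qed.

(** Scaling carries the supremum over the unit ball to all of l2. The two Bessel bounds make that
    supremum finite, and settle [l2norm c = 0], where scaling is impossible. *)
Lemma cross_gram_le c : is_l2 c ->
  is_l2 (G c) /\ l2norm (G c) <= l2opnorm G * l2norm c.
Proof.
move=> c2; have [B [B' [B0 B'0 phiB psiB]]] := dual_bessel.
have G2 d := (analysis_l2 B'0 psiB (synthesis phi d)).1 : is_l2 (G d).
have G_le d : is_l2 d -> l2norm (G d) <= Num.sqrt B' * Num.sqrt B * l2norm d.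
  move=> d2; rewrite (le_trans (analysis_l2 B'0 psiB _).2)// -mulrA.
  by rewrite ler_wpM2l ?sqrtr_ge0//; exact: synthesis_le.
split=> //; have [c0|c0] := eqVneq (l2norm c) 0.
  by rewrite c0 mulr0 (le_trans (G_le _ c2))// c0 mulr0.
have {}c0 : 0 < l2norm c by rewrite lt_def c0 l2norm_ge0.
pose d n := (l2norm c)^-1%:C * c n.
have [d2 d1] := is_l2Z (l2norm c)^-1%:C c2.
have {}d1 : l2norm d <= 1.
  by rewrite (le_trans d1)// nrm_real ger0_norm ?invr_ge0 ?l2norm_ge0// mulVf ?gt_eqF.
have cE n : c n = (l2norm c)%:C * d n.
  by rewrite /d mulrA -rmorphM mulfV ?gt_eqF// rmorph1 mul1r.
have GcE : G c = (fun n => (l2norm c)%:C * G d n).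
  apply/funext => n; rewrite /G /cross_gram.
  (* A pure scalar multiple is obtained by writing c = (t - 1) d + d with t = [l2norm c]. *)
  rewrite (@synthesisP _ _ _ hip _ _ B0 phiB ((l2norm c)%:C - 1) d d c)//; last first.
    by move=> k; rewrite cE mulrBl mul1r subrK.
  by rewrite analysisP mulrBl mul1r subrK.
rewrite GcE (le_trans (is_l2Z _ (G2 d)).2)// nrm_real ger0_norm ?l2norm_ge0//.
rewrite mulrC ler_wpM2r ?l2norm_ge0//; apply: sup_ubound; last by exists d.
exists (Num.sqrt B' * Num.sqrt B) => _ [e [e2 e1] <-].
by rewrite (le_trans (G_le _ e2))// ler_piMr// mulr_ge0 ?sqrtr_ge0.
Qed.

Lemma cross_gram_opnorm_ge0 : 0 <= l2opnorm G.
Proof.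
rewrite /l2opnorm; set A := [set _ | _ in _].
(* A set without supremum has [sup] equal to 0 by convention. *)
have [hA|/sup_out->//] := pselect (has_sup A).
have [[x Ax] ubA] := hA; apply: le_trans (sup_ubound ubA Ax).
by case: Ax => c _ <-; exact: l2norm_ge0.
Qed.

Variables (a : nat -> R[i]) (r : R).
Hypotheses (r0 : 0 <= r) (ar : forall n, nrm (a n) <= r).

Lemma multiplier_linear : linear (multiplier ip a phi psi).
Proof.
have [B [B' [B0 B'0 phiB psiB]]] := dual_bessel => x f g.
have a2 h := (is_l2M r0 ar (analysis_l2 B'0 psiB h).1).1.
apply: (synthesisP hip B0 phiB (a2 f) (a2 g)) => n.
by rewrite linearPl/= mulrDr mulrCA.
Qed.

(** Since (D a C)^(k+1) = D (a G)^k a C, the outer D, a and C contribute a constant and only k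
    factors [r * l2opnorm G] appear; hence the exponent [k.-1]. *)
Lemma multiplier_iter_le : exists2 K : R, 0 <= K & forall k f,
  nrm (iter k (multiplier ip a phi psi) f) <=
  K * (r * l2opnorm G) ^+ k.-1 * nrm f.
Proof.
have [B [B' [B0 B'0 phiB psiB]]] := dual_bessel.
(* [w f k] is (a G)^k a C f, the coefficient sequence before the final synthesis. *)
pose w f k := iter k (fun c n => a n * G c n) (fun n => a n * analysis ip psi f n).
have wE f k : iter k.+1 (multiplier ip a phi psi) f = synthesis phi (w f k).
  by elim: k => // k IH; rewrite iterS IH.
have w_le f k : is_l2 (w f k) /\
    l2norm (w f k) <= (r * l2opnorm G) ^+ k * (r * (Num.sqrt B' * nrm f)).
  elim: k => [|k [w2 wk]].
    have [a2 a_le] := analysis_l2 B'0 psiB f.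
    have [? /le_trans le] := is_l2M r0 ar a2; split => //.
    by rewrite expr0 mul1r le// ler_wpM2l.
  have [G2 G_le] := cross_gram_le w2.
  have [? /le_trans le] := is_l2M r0 ar G2; split => //.
  rewrite le// exprS -!mulrA ler_wpM2l//= (le_trans G_le)//.
  by rewrite ler_wpM2l ?cross_gram_opnorm_ge0.
(* The 1 covers k = 0, where the iterate is the identity. *)
pose K := Num.max 1 (Num.sqrt B * r * Num.sqrt B').
have K0 : 0 <= K by rewrite le_max ler01.
exists K => // -[|k] f.
  by rewrite /= expr0 mulr1 ler_peMl ?nrm_ge0// le_max lexx.
have [w2 wk] := w_le f k.
rewrite wE (le_trans (synthesis_le hip B0 phiB w2))//.
rewrite (le_trans (ler_wpM2l (sqrtr_ge0 _) wk))//=.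
rewrite [leLHS](_ : _ = Num.sqrt B * r * Num.sqrt B' *
  ((r * l2opnorm G) ^+ k * nrm f)); last by ring.
rewrite -[leRHS]mulrA ler_wpM2r ?le_max ?lexx ?orbT//.
by rewrite mulr_ge0 ?nrm_ge0// exprn_ge0// mulr_ge0// cross_gram_opnorm_ge0.
Qed.

End Multipliers.

(** * Localisation of the spectrum in a disk *)

Section Spectrum.
Variables (R : realType) (H : completeNormedModType R[i]).
Variable ip : {dot H for conjC}.
Hypothesis hip : induces_norm ip.
Variables (phi psi : nat -> H).
Hypothesis hdual : dual_frames ip phi psi.

Let G := cross_gram ip phi psi.

Lemma spectrum_multiplier_disk (m : nat -> R[i]) (mu lam : R[i]) (r : R) :
  (forall n, nrm (mu - m n) <= r) -> spectrum (multiplier ip m phi psi) lam ->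
  nrm (mu - lam) <= r * l2opnorm G.
Proof.
move=> mr; rewrite leNgt => sp; apply/negP => nu_gt; apply: sp.
have r0 : 0 <= r := le_trans (nrm_ge0 _) (mr 0%N).
pose a n := m n - mu.
have ar n : nrm (a n) <= r by rewrite -nrmN opprB.
pose q := r * l2opnorm G.
have q0 : 0 <= q by rewrite mulr_ge0 ?cross_gram_opnorm_ge0.
(* The midpoint lies strictly below |lam - mu|, and is positive even if q = 0, so it can be
   inverted. *)
pose q' := (q + nrm (mu - lam)) / 2.
have qq' : q <= q' by rewrite /q'; move: nu_gt; rewrite -/q; lra.
have q'0 : 0 < q' by rewrite /q'; move: nu_gt; rewrite -/q; lra.
have q'nu : q' < nrm (lam - mu).
  by rewrite -nrmN opprB /q'; move: nu_gt; rewrite -/q; lra.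
have [K K0 MK] := multiplier_iter_le hip hdual r0 ar.
(* In the factor 1 + 1/q', the 1 serves k = 0 and 1/q' restores the power lost in [k.-1]. *)
have := @neumann_inverse _ _ (multiplier ip a phi psi) (K * (1 + q'^-1)) q' (lam - mu).
case.
- exact: (multiplier_linear hip hdual r0 ar).
- by rewrite mulr_ge0// addr_ge0// invr_ge0 ltW.
- by rewrite ltW.
- move=> k f; rewrite (le_trans (MK k f))// ler_wpM2r ?nrm_ge0//.
  rewrite -mulrA ler_wpM2l//; case: k => [|k] /=.
    by rewrite !expr0 mulr1 lerDl invr_ge0 ltW.
  apply: (@le_trans _ _ (q' ^+ k)); first by rewrite lerXn2r ?nnegrE// ltW.
  rewrite mulrDl mul1r exprS mulrA mulVf ?gt_eqF// mul1r lerDr.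
  by rewrite mulr_ge0 ?exprn_ge0// ltW.
move=> S [contS TS ST]; exists S.
have E f : multiplier ip m phi psi f - lam *: f =
    multiplier ip a phi psi f - (lam - mu) *: f.
  have [B [B' [B0 B'0 phiB psiB]]] := dual_bessel hdual.
  have [C2 _] := analysis_l2 B'0 psiB f.
  have aC2 := (is_l2M r0 ar C2).1.
  have -> : multiplier ip m phi psi f = mu *: f + multiplier ip a phi psi f.
    have [_ _ /(_ f) fE] := hdual.
    (* Duality, D C = 1, presents [mu *: f] as mu times the synthesis of C f, so the symbols mu and
       a add up to m. *)
    rewrite -[in mu *: f](cvg_lim (@norm_hausdorff _ H) fE).
    apply: (synthesisP hip B0 phiB C2 aC2) => n.
    by rewrite /a /analysis mulrBl addrC subrK.
  by rewrite scalerBl opprB addrA [mu *: f + _]addrC.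
split => // f; first by rewrite E TS.
by rewrite E ST.
Qed.

End Spectrum.

(** * The cross Gram operator of a canonical dual is a contraction *)

Section CanonicalDual.
Variables (R : realType) (H : completeNormedModType R[i]).
Variable ip : {dot H for conjC}.
Hypothesis hip : induces_norm ip.
Variables (phi psi : nat -> H) (B : R).
Hypotheses (B0 : 0 < B) (phiB : bessel ip phi B).

Lemma frame_operator_cvg f :
  series (fun n => ip f (phi n) *: phi n) @ \oo --> frame_operator ip phi f.
Proof. exact: (synthesis_cvg hip B0 phiB (analysis_l2 B0 phiB f).1). Qed.

(** Both sides are limits of the same partial sums of <f, phi_n> <phi_n, g>. *)
Lemma frame_operator_selfadjoint f g :
  ip (frame_operator ip phi f) g = ip f (frame_operator ip phi g).
Proof.
have lim1 := cvg_ipl hip (v := g) (frame_operator_cvg (f := f)).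
have lim2 := cvg_ipr hip (v := f) (frame_operator_cvg (f := g)).
rewrite (_ : (fun n => _) = (fun n => ip f (series (fun n => ip g (phi n) *: phi n) n)
  : R[i]^o)) in lim1.
  exact: (@cvg_unique _ (@norm_hausdorff _ R[i]^o) _ _ _ _ lim1 lim2).
apply/funext => N; rewrite /series/= linear_sumlz linear_sumr.
apply: eq_bigr => n _.
by rewrite linearZl_LR linearZr_LR/= mulrC -ip_conj.
Qed.

(* For the canonical dual, [G c] is the analysis by phi of h, the preimage of
   [D c] under the frame operator F, so that
   [||G c||^2 = <F h, h> = <D c, h> = <c, G c>]. *)
Lemma canonical_cross_gram_le (c : nat -> R[i]) :
  is_canonical_dual ip phi psi -> is_l2 c ->
  l2norm (cross_gram ip phi psi c) <= l2norm c.
Proof.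
move=> [S [contS TS ST] psiE] c2.
set x := synthesis phi c; pose h := S x.
have hE : frame_operator ip phi h = x by rewrite /h ST.
pose y := analysis ip phi h.
have -> : cross_gram ip phi psi c = y.
  (* With x = F h, self-adjointness moves F onto psi_n = S phi_n, where F S = 1. *)
  apply/funext => n; rewrite /cross_gram /analysis -/x -hE psiE.
  by rewrite frame_operator_selfadjoint ST.
have y2 : is_l2 y := (analysis_l2 B0 phiB h).1.
have lim1 : (fun n => (\sum_(0 <= k < n) nrm (y k) ^+ 2)%:C : R[i]^o) @ \oo
    --> (ip x h : R[i]^o).
  have := cvg_ipl hip (v := h) (frame_operator_cvg (f := h)); rewrite hE.
  set v := (fun n => ip _ h); set w := (fun n => _%:C).
  suff -> : v = w by [].
  apply/funext => N; rewrite /v /w.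
  rewrite /series/= linear_sumlz rmorph_sum; apply: eq_bigr => n _.
  by rewrite linearZl_LR/= (ip_conj _ (phi n)) -normCK normE rmorphXn.
have ge_y : l2norm y ^+ 2 <= nrm (ip x h).
  rewrite -[leRHS]sqr_sqrtr ?nrm_ge0// ler_sqr ?nnegrE ?l2norm_ge0 ?sqrtr_ge0//.
  apply: (proj2 (iffRL (l2norm_leP y (sqrtr_ge0 _)) _)) => N.
  rewrite sqr_sqrtr ?nrm_ge0//; apply/ler_addgt0Pr => e e0.
  have [M _ hM] := (iffLR (cvg_nrmP _ _) lim1) _ e0.
  (* At index [maxn M N] the partial sum is close to the limit and still dominates the one at N. *)
  have {hM} := hM (maxn M N) (leq_maxl _ _); set s := \sum_(_ <= _ < _) _ => hs.
  apply: (@le_trans _ _ s).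
    rewrite /s (@big_cat_nat _ _ _ N 0 (maxn M N))//= ?leq_maxr// lerDl.
    by rewrite sumr_ge0// => k _; rewrite sqr_ge0.
  have s0 : 0 <= s by rewrite sumr_ge0// => k _; rewrite sqr_ge0.
  rewrite -[s]ger0_norm// -nrm_real -[s%:C](subKr (ip x h)).
  by rewrite (le_trans (nrmD _ _))// lerD2l nrmN ltW.
(* Termwise AM-GM on <c, y>; together with [ge_y], half of |y|^2 is absorbed and |y|^2 <= |c|^2
   remains. *)
have le_y : nrm (ip x h) <= 2^-1 * (l2norm c ^+ 2 + l2norm y ^+ 2).
  apply: (cvg_nrm_lim_le (cvg_ipl hip (v := h) (synthesis_cvg hip B0 phiB c2))) => N.
  rewrite /series/= linear_sumlz.
  apply: le_trans (_ : 2^-1 * (\sum_(0 <= n < N) nrm (c n) ^+ 2 +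
      \sum_(0 <= n < N) nrm (y n) ^+ 2) <= _); last first.
    by rewrite ler_wpM2l ?invr_ge0// lerD// is_l2_psum.
  rewrite -big_split/= mulr_sumr.
  elim/big_ind2 : _ => [|x1 x2 y1 y2' h1 h2|n _]; first by rewrite nrm0.
    by rewrite (le_trans (nrmD _ _))// lerD.
  rewrite linearZl_LR/= nrmM nrm_ipC//.
  rewrite -/(analysis ip phi h n) -/y -subr_ge0.
  rewrite (_ : _ - _ = 2^-1 * (nrm (c n) - nrm (y n)) ^+ 2); last by field.
  by rewrite mulr_ge0 ?sqr_ge0 ?invr_ge0.
rewrite -ler_sqr ?nnegrE ?l2norm_ge0//.
move: ge_y le_y; lra.
Qed.

Lemma canonical_cross_gram_opnorm_le1 :
  is_canonical_dual ip phi psi -> l2opnorm (cross_gram ip phi psi) <= 1.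
Proof.
move=> can; rewrite /l2opnorm; set A := [set _ | _ in _].
have [[A0 _]|/sup_out->//] := pselect (has_sup A).
apply: ge_sup => // _ [c [c2 c1] <-].
exact: le_trans (canonical_cross_gram_le can c2) c1.
Qed.

End CanonicalDual.

(** * Separating a point from a closed convex set by a disk *)

Section Separation.
Variable R : realType.

Lemma closed_dist_gt0 (B : set R[i]^o) (lam : R[i]) : closed B -> ~ B lam ->
  exists2 d : R, 0 < d & forall y, B y -> d <= nrm (lam - y).
Proof.
move=> cB Blam.
have : nbhs (lam : R[i]^o) (~` B).
  by apply: open_nbhs_nbhs; split => //; exact: closed_openC.
move=> /nbhs_ballP[e /= e0 eB].
have eE : e = (complex.Re e)%:C by rewrite RRe_real// gtr0_real.
exists (complex.Re e); first by rewrite -ltcR -eE.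
move=> y By; rewrite leNgt; apply/negP => ly.
by apply: (eB y) By; rewrite -ball_normE/= eE normE ltcR.
Qed.

(** Passes from a real weight to one packaged in [{i01 R[i]}]. *)
Lemma convex_set_segment (B : set R[i]^o) (x y : R[i]) (t : R) :
  convex_set B -> 0 <= t <= 1 -> B x -> B y ->
  B (t%:C * x + (1 - t)%:C * y).
Proof.
move=> cB /andP[t0 t1] Bx By.
have t01 : (0 <= (t%:C : R[i]) <= 1)%R by rewrite ler0c t0 -[1]/(1%:C) lecR.
pose T : {i01 R[i]} := Itv01 (proj1 (andP t01)) (proj2 (andP t01)).
have := cB x y T (mem_set Bx) (mem_set By); rewrite inE.
by rewrite rmorphB.
Qed.

(* A near-minimiser [p] of the distance to [lam] in B replaces the projection
   of [lam] on B; the disk is centred far away on the ray from [lam] through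
   [p], so that it approximates the supporting half-plane at [p]. *)
Lemma disk_separation (B : set R[i]^o) (z : nat -> R[i]) (L : R) (lam : R[i]) :
  closed B -> convex_set B -> (forall n, B (z n)) ->
  (forall n, nrm (z n) <= L) -> ~ B lam ->
  exists mu r, (forall n, nrm (mu - z n) <= r) /\ r < nrm (mu - lam).
Proof.
move=> cB convB Bz zL Blam.
have [d d0 hd] := closed_dist_gt0 cB Blam.
pose E := [set nrm (lam - y) ^+ 2 | y in B].
have Einf : has_inf E.
  split; first by exists (nrm (lam - z 0%N) ^+ 2), (z 0%N).
  by exists 0 => _ [y _ <-]; exact: sqr_ge0.
pose I := inf E.
have I0 : 0 < I.
  apply: (@lt_le_trans _ _ (d ^+ 2)); first by rewrite exprn_gt0.
  apply: lb_le_inf; first exact: Einf.1.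
  move=> _ [y By <-]; rewrite ler_sqr ?nnegrE ?nrm_ge0 ?(ltW d0)//.
  exact: hd.
have L0 : 0 <= L := le_trans (nrm_ge0 _) (zL 0%N).
have lam0 := nrm_ge0 lam.
(* [W] is chosen to bound every |z_n - p|^2 and also I^2. *)
pose W := (L + nrm lam + I + 2) ^+ 2.
have WI : (I + 2) ^+ 2 <= W by rewrite /W ler_sqr ?nnegrE; lra.
have W0 : 0 < W by rewrite /W exprn_gt0//; lra.
(* [t] is the length of a step from p towards z_n. As t W = I/2, the quadratic term t^2 W equals t
   I/2, the slack allowed to p. *)
pose t := I / (2 * W).
have tW : t * W = I / 2 by rewrite /t; field; rewrite gt_eqF.
have t0 : 0 < t by rewrite /t divr_gt0// mulr_gt0.
have t1 : t <= 1 by rewrite /t ler_pdivrMr ?mulr_gt0//; nra.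
(* Keeps |u|^2 below I + 1, whence |u| <= I + 2. *)
have tI1 : t * I / 2 <= 1.
  have : t * I <= t * W by rewrite ler_wpM2l ?(ltW t0)//; nra.
  have : I * I <= W by nra.
  have -> : t * I = I * I / W / 2 by rewrite /t; field; rewrite gt_eqF.
  move=> IW _; have : I * I / W <= 1 by rewrite ler_pdivrMr// mul1r.
  lra.
have [_ [p Bp <-] pI] : exists2 x, E x & x < I + t * I / 2.
  by apply: inf_adherent => //; rewrite divr_gt0// mulr_gt0.
set u := lam - p in pI.
have Iu : I <= nrm u ^+ 2 by apply: ge_inf; [exact: Einf.2|exists p].
pose dot n := complex.Re u * complex.Re (z n - p) + complex.Im u * complex.Im (z n - p).
have vW n : nrm (z n - p) ^+ 2 <= W.
  rewrite /W ler_sqr ?nnegrE ?nrm_ge0//; last by lra.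
  have -> : z n - p = z n + (u - lam) by rewrite /u addrAC subrr add0r.
  rewrite (le_trans (nrmD _ _))//; have := nrmD u (- lam); rewrite nrmN.
  have := zL n; have := nrm_ge0 u.
  have : nrm u <= I + 2 by have := nrm_ge0 u; nra.
  lra.
(* Approximate variational inequality: p + t (z_n - p) is in B, so its squared distance to [lam] is
   at least I; an exact projection would give [dot n <= 0]. *)
have dotI n : 2 * dot n <= I.
  have By := convex_set_segment convB (introT andP (conj (ltW t0) t1)) (Bz n) Bp.
  have : I <= nrm (lam - (t%:C * z n + (1 - t)%:C * p)) ^+ 2.
    by apply: ge_inf; [exact: Einf.2|exists (t%:C * z n + (1 - t)%:C * p)].
  have -> : lam - (t%:C * z n + (1 - t)%:C * p) = u - t%:C * (z n - p).
    by rewrite /u rmorphB rmorph1; ring.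
  have -> : nrm (u - t%:C * (z n - p)) ^+ 2 =
      nrm u ^+ 2 - 2 * t * dot n + t ^+ 2 * nrm (z n - p) ^+ 2.
    rewrite !nrm_sqr /dot; case: (u) => u1 u2; case: (z n - p) => v1 v2 /=.
    by ring.
  have : t ^+ 2 * nrm (z n - p) ^+ 2 <= t * (t * W).
    by rewrite mulrA -expr2 ler_wpM2l ?sqr_ge0.
  rewrite tW => h1 h2.
  have : t * (2 * dot n) <= t * I by lra.
  by rewrite ler_pM2l.
(* With this [s], W + s I = 2 s I - I < (1 + 2 s) I, which leaves [lam] outside the disk. *)
pose s := W / I + 1.
have sI : s * I = W + I by rewrite /s mulrDl divfK ?gt_eqF// mul1r.
have s0 : 0 < s by rewrite /s addr_gt0// divr_gt0.
pose mu := p - s%:C * u.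
exists mu, (Num.sqrt (W + s * I + s ^+ 2 * nrm u ^+ 2)).
have rad0 : 0 <= W + s * I + s ^+ 2 * nrm u ^+ 2.
  have := mulr_ge0 (ltW s0) (ltW I0); have := ltW W0.
  have := mulr_ge0 (sqr_ge0 s) (sqr_ge0 (nrm u)); lra.
split=> [n|].
  rewrite -ler_sqr ?nnegrE ?nrm_ge0 ?sqrtr_ge0// sqr_sqrtr//.
  have -> : nrm (mu - z n) ^+ 2 =
      nrm (z n - p) ^+ 2 + s * (2 * dot n) + s ^+ 2 * nrm u ^+ 2.
    rewrite /mu (_ : _ - _ = - (s%:C * u + (z n - p))); last by ring.
    rewrite nrmN !nrm_sqr /dot; case: (u) => u1 u2; case: (z n - p) => v1 v2 /=.
    by ring.
  by rewrite lerD2r lerD// ler_wpM2l// ltW.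
have -> : mu - lam = - ((1 + s)%:C * u) by rewrite /mu /u (rmorphD _ 1 s) rmorph1; ring.
rewrite -ltr_sqr ?nnegrE ?nrm_ge0 ?sqrtr_ge0// sqr_sqrtr//.
have s1 : `|1 + s| = 1 + s by rewrite ger0_norm//; lra.
rewrite nrmN nrmM nrm_real s1 exprMn.
have : s * I <= s * nrm u ^+ 2 by rewrite ler_wpM2l ?(ltW s0).
move: Iu I0 sI; lra.
Qed.

End Separation.

(** * Disks and bounded symbols in terms of the real norm, and the three inclusions *)

Lemma closed_diskE (R : realType) (mu z : R[i]) (r : R) :
  closed_disk mu r z <-> nrm (mu - z) <= r.
Proof. by rewrite /closed_disk /closed_ball_/= normE lecR. Qed.

Lemma bounded_fun_nrm (R : realType) (m : nat -> R[i]) :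
  bounded_fun (m : nat -> R[i]^o) -> exists L, forall n, nrm (m n) <= L.
Proof.
move=> [M [Mreal hM]]; exists (complex.Re M + 1) => n.
have {}hM : `|m n| <= M + 1 by apply: (hM (M + 1)) => //; rewrite ltrDl.
by rewrite -lecR -normE rmorphD/= RRe_real.
Qed.

Theorem theorem3p4 (R : realType) (H : completeNormedModType R[i])
    (ip : {dot H for conjC}) (hip : induces_norm ip) (hsep : separable H)
    (phi psi : nat -> H) (hdual : dual_frames ip phi psi)
    (m : nat -> R[i]) (hm : bounded_fun (m : nat -> R[i]^o)) :
  [/\ (forall (mu : R[i]) (r : R),
        (forall n, closed_disk mu r (m n)) ->
        spectrum (multiplier ip m phi psi) `<=`
          closed_disk mu (r * l2opnorm (cross_gram ip phi psi))),
      ((forall n, m n \is Num.real) ->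
        let M := sup (range (fun n => complex.Re (m n))) in
        let m0 := inf (range (fun n => complex.Re (m n))) in
        spectrum (multiplier ip m phi psi) `<=`
          closed_disk (2^-1 * (M + m0))%:C
            (2^-1 * (M - m0) * l2opnorm (cross_gram ip phi psi)))
    & (is_canonical_dual ip phi psi ->
        spectrum (multiplier ip m phi psi) `<=`
          closed_convex_hull (range m))].
Proof.
split.
- move=> mu r mr lam /(spectrum_multiplier_disk hip hdual) h.
  by apply/closed_diskE/h => n; apply/closed_diskE.
- move=> mreal M m0 lam /(spectrum_multiplier_disk hip hdual) h.
  apply/closed_diskE/h => n.
  (* Boundedness of m makes [M] and [m0] genuine bounds; the centre is their midpoint, so the
     distance to it is at most half of M - m0. *)
  have [L mL] := bounded_fun_nrm hm.
  have absL k : `|complex.Re (m k)| <= L.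
    by rewrite -nrm_real RRe_real//; exact: mL.
  have mM : complex.Re (m n) <= M.
    apply: sup_ubound; last by exists n.
    by exists L => _ [k _ <-]; rewrite (le_trans (ler_norm _)).
  have m0m : m0 <= complex.Re (m n).
    apply: ge_inf; last by exists n.
    by exists (- L) => _ [k _ <-]; have := absL k; rewrite ler_norml => /andP[].
  by rewrite -(RRe_real (mreal n)) -rmorphB nrm_real ler_norml; lra.
- move=> can lam splam B [[cB convB] mB]; apply: contrapT => Blam.
  have [L mL] := bounded_fun_nrm hm.
  have Bm n : B (m n) by apply: mB; exists n.
  (* A disk containing all m_n but not [lam] contradicts the disk bound, because [l2opnorm] is at
     most 1 and r >= 0. *)
  have [mu [r [mr]]] := disk_separation cB convB Bm mL Blam.
  rewrite ltNge => /negP; apply.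
  rewrite (le_trans (spectrum_multiplier_disk hip hdual mr splam))//.
  have [B1 [_ [B10 _ phiB _]]] := dual_bessel hdual.
  rewrite ler_piMr ?(le_trans (nrm_ge0 _) (mr 0%N))//.
  exact: (canonical_cross_gram_opnorm_le1 hip B10 phiB can).
Qed.
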